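(* Let $G$ be a perfect group and $X$ a conjugacy class of $G$ such that $G$ is generated by $X$. With the notation $\mathrm{As}(X)$, $D_X$, $\pi$, $d$, $g_x$, $M(G)$, $\mu_x$ of the context: (1) The subgroup $\mu_x(C_G(x))$ of $M(G)$ is independent of the choice of $x\in X$. (2) The group $D_X$ is a central extension of $G$ by $M(G)/\mu_x(C_G(x))$ (via the map $\pi|_{D_X}:D_X\to G$). (3) Let $x_0\in X$, and let $g_0\in D_X$ be such that $\pi(g_0)=x_0$. The map $$\mathrm{As}(X)\to D_X\times\mathbb{Z},\qquad g\mapsto\big(g\,g_{x_0}^{-d(g)}g_0^{d(g)},\,d(g)\big),$$ is an isomorphism of groups.
   Context: $X$ is a rack via $x\triangleright y=xyx^{-1}$. Let $F_X$ be the free group on symbols $g_x$, $x\in X$, and $R_0$ the smallest normal subgroup of $F_X$ containing all $g_xg_yg_x^{-1}g_{x\triangleright y}^{-1}$, $x,y\in X$. The associated group of $X$ is $\mathrm{As}(X)=F_X/R_0$; the image of $g_x$ in it is again written $g_x$. Let $D_X=[\mathrm{As}(X),\mathrm{As}(X)]$. Let $\pi:F_X\to G$ be the group homomorphism with $\pi(g_x)=x$ and $d:F_X\to\mathbb{Z}$ the one with $d(g_x)=1$ for all $x\in X$; both factor through $\mathrm{As}(X)$, and the induced maps are again denoted $\pi$ and $d$. Let $R_X=\ker(\pi:F_X\to G)$. The Schur multiplier of $G$ is $M(G)=(R_X\cap[F_X,F_X])/[F_X,R_X]$. The map $\pi$ also induces a map $F_X/[F_X,R_X]\to G$, again denoted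 $\pi$. $C_G(x)$ is the centralizer of $x$. For $x\in X$, $\mu_x:C_G(x)\to(R_X\cap[F_X,F_X])/[F_X,R_X]=M(G)$ is the well-defined group homomorphism with $\mu_x(g)=hyh^{-1}y^{-1}$ for any $h\in F_X/[F_X,R_X]$ with $\pi(h)=g$ and any $y\in F_X/[F_X,R_X]$ with $\pi(y)=x$. The factor group $M(G)/\mu_x(C_G(x))$ is called the Schur multiplier of $G$ relative to $X$. A central extension of $G$ by an abelian group $K$ is a group $H$ with a surjective homomorphism $H\to G$ whose kernel is central in $H$ and isomorphic to $K$. *)

(* Defs.v *)
From HB Require Import structures.
From mathcomp Require Import all_boot ssralg ssrint.
From mathcomp Require Import boolp classical_sets.

Set Implicit Arguments.
Unset Strict Implicit.
Unset Printing Implicit Defensive.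

Identity Coercion fun_of_set : set >-> Funclass.

Local Open Scope quotient_scope.
Local Open Scope classical_set_scope.
Local Open Scope group_scope.

(* Groups are arbitrary, possibly infinite, [groupType]s; subgroups and normal
   subgroups are bundled subsets, so that they have an underlying group and a
   quotient group respectively. *)

Notation "{ 'ghom' G -> H }" := (UMagmaMorphism.type G%type H%type)
  (at level 0, G at level 98, H at level 99, format "{ 'ghom'  G  ->  H }") :
  type_scope.

Record subgroup (G : groupType) := Subgroup {
  subgroup_set :> set G;
  subgroup1 : subgroup_set 1;
  subgroupF : forall u v, subgroup_set u -> subgroup_set v -> subgroup_set (u / v)
}.

Record nsubgroup (G : groupType) := NSubgroup {
  nsubgroup_subgroup :> subgroup G;
  nsubgroupJ : forall g u, nsubgroup_subgroup u -> nsubgroup_subgroup (u ^ g)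
}.

Section SubgroupTheory.
Variables (G : groupType) (H : subgroup G).

Lemma subgroupV u : H u -> H u^-1.
Proof. by move=> Hu; rewrite -div1g; apply: subgroupF => //; apply: subgroup1. Qed.

Lemma subgroupM u v : H u -> H v -> H (u * v).
Proof. by move=> Hu Hv; rewrite -[v]invgK; apply/subgroupF/subgroupV. Qed.

Lemma subgroup_group_closed : group_closed (mem (subgroup_set H)).
Proof.
split; first exact/mem_set/subgroup1.
by move=> u v /set_mem Hu /set_mem Hv; apply/mem_set/subgroupF.
Qed.

End SubgroupTheory.

HB.instance Definition _ (T : choiceType) (A : set T) :=
  SubChoice.copy (set_type A) {x : T | x \in A}.

HB.instance Definition _ (G : groupType) (H : subgroup G) :=
  SubChoice_isSubGroup.Build G _ (set_type H) (subgroup_group_closed H).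

Section Constructions.
Variable G : groupType.
Implicit Types A B : set G.

Definition full_subgroup : subgroup G :=
  @Subgroup G [set: G] I (fun _ _ _ _ => I).

Definition full_nsubgroup : nsubgroup G :=
  @NSubgroup G full_subgroup (fun _ _ _ => I).

Definition generated_set A : set G :=
  [set g | forall H : subgroup G, A `<=` H -> H g].

Fact generated1 A : generated_set A 1.
Proof. by move=> H _; apply: subgroup1. Qed.

Fact generatedF A u v :
  generated_set A u -> generated_set A v -> generated_set A (u / v).
Proof. by move=> Au Av H AH; apply: subgroupF; [apply: Au|apply: Av]. Qed.

Definition generated A : subgroup G := Subgroup (@generated1 A) (@generatedF A).

Lemma generated_sub A : A `<=` generated A.
Proof. by move=> a Aa H; apply. Qed.

Definition nclosure_set A : set G :=
  [set g | forall N : nsubgroup G, A `<=` N -> N g].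

Fact nclosure1 A : nclosure_set A 1.
Proof. by move=> N _; apply: subgroup1. Qed.

Fact nclosureF A u v :
  nclosure_set A u -> nclosure_set A v -> nclosure_set A (u / v).
Proof. by move=> Au Av N AN; apply: subgroupF; [apply: Au|apply: Av]. Qed.

Fact nclosureJ A g u : nclosure_set A u -> nclosure_set A (u ^ g).
Proof. by move=> Au N AN; apply: nsubgroupJ; apply: Au. Qed.

Definition nclosure A : nsubgroup G :=
  @NSubgroup G (Subgroup (@nclosure1 A) (@nclosureF A)) (@nclosureJ A).

Definition commutator A B : subgroup G :=
  generated [set [~ a, b] | a in A & b in B].

(* [M, N] is normal when M and N are: it is contained in the preimage of
   [M, N] under conjugation by any element. *)
Fact conj_preim1 (H : subgroup G) g : [set u | H (u ^ g)] 1.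
Proof. by rewrite /= conj1g; apply: subgroup1. Qed.

Fact conj_preimF (H : subgroup G) g u v :
  [set u | H (u ^ g)] u -> [set u | H (u ^ g)] v -> [set u | H (u ^ g)] (u / v).
Proof. by move=> /= Hu Hv; rewrite conjMg conjVg; apply: subgroupF. Qed.

Fact ncommutatorJ (M N : nsubgroup G) g u :
  commutator M N u -> commutator M N (u ^ g).
Proof.
move/(_ (Subgroup (@conj_preim1 (commutator M N) g)
                  (@conj_preimF (commutator M N) g))); apply.
move=> _ [a Ma [b Nb <-]] /=; rewrite conjRg; apply: generated_sub.
by exists (a ^ g); [apply: nsubgroupJ | exists (b ^ g) => //; apply: nsubgroupJ].
Qed.

Definition ncommutator (M N : nsubgroup G) : nsubgroup G :=
  NSubgroup (@ncommutatorJ M N).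

Definition derived : subgroup G := commutator [set: G] [set: G].

Fact centralizer1 (x : G) : [set g | commute x g] 1.
Proof. exact: commute1. Qed.

Fact centralizerF (x u v : G) :
  [set g | commute x g] u -> [set g | commute x g] v ->
  [set g | commute x g] (u / v).
Proof. by move=> xu xv; apply/commuteM/commuteV. Qed.

Definition centralizer (x : G) : subgroup G :=
  Subgroup (@centralizer1 x) (@centralizerF x).

Lemma central_mul_commutator (a b h y : G) :
    (forall z, commute z a) -> (forall z, commute z b) ->
  a * h * (b * y) * (a * h)^-1 * (b * y)^-1 = h * y * h^-1 * y^-1.
Proof.
move=> ca cb; have cbV z : commute z b^-1 by apply/commuteV/cb.
have -> : a * h * (b * y) * (a * h)^-1 = b * (h * y * h^-1).
  have -> : a * h * (b * y) * (a * h)^-1 = a * (h * (b * y) * h^-1) * a^-1.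
    by rewrite invgM !mulgA.
  by rewrite -ca mulgK !mulgA (cb h).
by rewrite invgM !mulgA cbV !mulgA mulVg mul1g.
Qed.

End Constructions.

Arguments derived : clear implicits.
Arguments full_subgroup : clear implicits.
Arguments full_nsubgroup : clear implicits.

Definition perfect (G : groupType) : Prop := derived G = [set: G] :> set G.

Definition abelian_group (G : groupType) : Prop := forall x y : G, x * y = y * x.

Definition generated_by (G : groupType) (X : set G) : Prop :=
  generated X = [set: G] :> set G.

Section Morphisms.
Variables (G H : groupType) (f : {ghom G -> H}).

Fact ker1 : [set g | f g = 1] 1.
Proof. exact: gmulf1. Qed.

Fact kerF u v : [set g | f g = 1] u -> [set g | f g = 1] v ->
  [set g | f g = 1] (u / v).
Proof. by move=> /= fu fv; rewrite gmulfF fu fv divg1. Qed.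

Fact kerJ g u : [set g | f g = 1] u -> [set g | f g = 1] (u ^ g).
Proof. by move=> /= fu; rewrite gmulfJ fu conj1g. Qed.

Definition ker : nsubgroup G := @NSubgroup G (Subgroup ker1 kerF) kerJ.

Fact image_subgroup1 (K : subgroup G) : (f @` K) 1.
Proof. by exists 1; [apply: subgroup1 | apply: gmulf1]. Qed.

Fact image_subgroupF (K : subgroup G) u v :
  (f @` K) u -> (f @` K) v -> (f @` K) (u / v).
Proof.
by move=> [a Ka <-] [b Kb <-]; exists (a / b); [apply: subgroupF | rewrite gmulfF].
Qed.

Definition image_subgroup (K : subgroup G) : subgroup H :=
  Subgroup (@image_subgroup1 K) (@image_subgroupF K).

End Morphisms.

Section Quotient.
Variables (G : groupType) (N : nsubgroup G).

Definition coset_rel : rel G := fun x y => x / y \in (N : set G).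

Fact coset_refl : reflexive coset_rel.
Proof. by move=> x; rewrite /coset_rel mulgV; apply/mem_set/subgroup1. Qed.

Fact coset_sym : symmetric coset_rel.
Proof.
have half x y : coset_rel x y -> coset_rel y x.
  by move=> /set_mem/subgroupV Nxy; apply/mem_set; rewrite -invgF.
by move=> x y; apply/idP/idP; apply: half.
Qed.

Fact coset_trans : transitive coset_rel.
Proof.
move=> y x z /set_mem Nxy /set_mem Nyz; apply/mem_set.
by rewrite -(divgKA y); apply: subgroupM.
Qed.

Canonical coset_equiv := EquivRel coset_rel coset_refl coset_sym coset_trans.

Definition quotient := {eq_quot coset_equiv}.

HB.instance Definition _ := Choice.on quotient.
HB.instance Definition _ := EqQuotient.on quotient.

Definition coset (x : G) : quotient := \pi_quotient x.

Lemma cosetP x y : coset x = coset y <-> N (x / y).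
Proof.
rewrite /coset; split=> [/eqP|Nxy]; first by rewrite eqquotE => /set_mem.
by apply/eqP; rewrite eqquotE; apply/mem_set.
Qed.

Lemma repr_coset (x : G) : N (repr (coset x) / x).
Proof. by apply/cosetP; rewrite /coset reprK. Qed.

Lemma coset_ind (P : quotient -> Prop) : (forall x, P (coset x)) -> forall q, P q.
Proof. by move=> Pc q; rewrite -[q]reprK; apply: Pc. Qed.

Definition quotient_one : quotient := coset 1.
Definition quotient_mul (a b : quotient) : quotient := coset (repr a * repr b).
Definition quotient_inv (a : quotient) : quotient := coset (repr a)^-1.

Lemma quotient_mulE x y : quotient_mul (coset x) (coset y) = coset (x * y).
Proof.
apply/cosetP; set a := repr _; set b := repr _.
have -> : a * b / (x * y) = (a / x) * (b / y) ^ x^-1.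
  by rewrite conjgE invgM invgK !mulgA mulgVK.
by apply: subgroupM; [|apply: nsubgroupJ]; apply: repr_coset.
Qed.

Lemma quotient_invE x : quotient_inv (coset x) = coset x^-1.
Proof.
apply/cosetP; set a := repr _.
have -> : a^-1 / x^-1 = ((a / x)^-1) ^ x by rewrite conjgE invgF invgK -mulgA mulKg.
by apply/nsubgroupJ/subgroupV/repr_coset.
Qed.

Fact quotient_mulA : associative quotient_mul.
Proof.
elim/coset_ind => x; elim/coset_ind => y; elim/coset_ind => z.
by rewrite !quotient_mulE mulgA.
Qed.

Fact quotient_mul1 : left_id quotient_one quotient_mul.
Proof. by elim/coset_ind => x; rewrite quotient_mulE mul1g. Qed.

Fact quotient_mulr1 : right_id quotient_one quotient_mul.
Proof. by elim/coset_ind => x; rewrite quotient_mulE mulg1. Qed.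

Fact quotient_mulV : left_inverse quotient_one quotient_inv quotient_mul.
Proof. by elim/coset_ind => x; rewrite quotient_invE quotient_mulE mulVg. Qed.

Fact quotient_mulrV : right_inverse quotient_one quotient_inv quotient_mul.
Proof. by elim/coset_ind => x; rewrite quotient_invE quotient_mulE mulgV. Qed.

HB.instance Definition _ := isGroup.Build quotient
  quotient_mulA quotient_mul1 quotient_mulr1 quotient_mulV quotient_mulrV.

Fact cosetF : {morph coset : x y / x / y}.
Proof. by move=> x y; rewrite -quotient_mulE -quotient_invE. Qed.

HB.instance Definition _ := isGroupMorphism.Build G quotient coset cosetF.

Lemma coset_eq1 x : coset x = 1 <-> N x.
Proof. by rewrite -[X in _ <-> N X]divg1; apply: cosetP. Qed.

End Quotient.

Section QuotientLift.
Variables (G H : groupType) (N : nsubgroup G) (f : {ghom G -> H}).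
Hypothesis fN : N `<=` ker f.

Definition quotient_lift_fun of N `<=` ker f := fun q : quotient N => f (repr q).

Lemma quotient_lift_funE x : quotient_lift_fun fN (coset N x) = f x.
Proof.
by apply: divg1_eq; rewrite -gmulfF; apply: fN; apply: repr_coset.
Qed.

Fact quotient_lift_funF : {morph quotient_lift_fun fN : x y / x / y}.
Proof.
elim/coset_ind => x; elim/coset_ind => y.
by rewrite -gmulfF !quotient_lift_funE gmulfF.
Qed.

HB.instance Definition _ :=
  isGroupMorphism.Build (quotient N) H (quotient_lift_fun fN) quotient_lift_funF.

Definition quotient_lift : {ghom quotient N -> H} := quotient_lift_fun fN.

Lemma quotient_liftE x : quotient_lift (coset N x) = f x.
Proof. exact: quotient_lift_funE. Qed.

End QuotientLift.

(* Words in the letters t and t^-1, coded (t, true) and (t, false), modulo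
   insertion and deletion of adjacent mutually inverse letters. *)
Inductive free_equiv (T : Type) : seq (T * bool) -> seq (T * bool) -> Prop :=
| FreeCancel u t b v : free_equiv (u ++ [:: (t, b), (t, ~~ b) & v]) (u ++ v)
| FreeRefl u : free_equiv u u
| FreeSym u v : free_equiv u v -> free_equiv v u
| FreeTrans u v w : free_equiv u v -> free_equiv v w -> free_equiv u w.

Section FreeGroup.
Variable T : choiceType.
Notation word := (seq (T * bool)).

Definition free_rel : rel word := fun u v => `[< free_equiv u v >].

Fact free_rel_refl : reflexive free_rel.
Proof. by move=> u; apply/asboolP/FreeRefl. Qed.

Fact free_rel_sym : symmetric free_rel.
Proof. by move=> u v; apply/asboolP/asboolP; apply: FreeSym. Qed.

Fact free_rel_trans : transitive free_rel.
Proof. by move=> v u w /asboolP uv /asboolP vw; apply/asboolP/(FreeTrans uv). Qed.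

Canonical free_rel_equiv :=
  EquivRel free_rel free_rel_refl free_rel_sym free_rel_trans.

Definition free_group := {eq_quot free_rel_equiv}.

HB.instance Definition _ := Choice.on free_group.
HB.instance Definition _ := EqQuotient.on free_group.

Definition of_word (u : word) : free_group := \pi_free_group u.

Lemma of_wordP u v : of_word u = of_word v <-> free_equiv u v.
Proof.
rewrite /of_word; split=> [/eqP|uv]; first by rewrite eqquotE => /asboolP.
by apply/eqP; rewrite eqquotE; apply/asboolP.
Qed.

Lemma repr_of_word u : free_equiv (repr (of_word u)) u.
Proof. by apply/of_wordP; rewrite /of_word reprK. Qed.

Lemma of_word_ind (P : free_group -> Prop) :
  (forall u, P (of_word u)) -> forall q, P q.
Proof. by move=> Pc q; rewrite -[q]reprK; apply: Pc. Qed.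

Definition word_inv (u : word) : word := rev [seq (l.1, ~~ l.2) | l <- u].

Lemma free_equiv_cat (u u' v v' : word) :
  free_equiv u u' -> free_equiv v v' -> free_equiv (u ++ v) (u' ++ v').
Proof.
move=> uu' vv'; apply: (@FreeTrans _ _ (u' ++ v)).
  elim: uu' => {u u' vv' v'} [u t b w|u|u u' _ uu'|u u' u'' _ uu' _ u'u''].
  - by rewrite -!catA; apply: FreeCancel.
  - exact: FreeRefl.
  - exact: FreeSym.
  - exact: FreeTrans u'u''.
elim: vv' => {u uu' v v'} [v t b w|v|v v' _ vv'|v v' v'' _ vv' _ v'v''].
- by rewrite !catA; apply: FreeCancel.
- exact: FreeRefl.
- exact: FreeSym.
- exact: FreeTrans v'v''.
Qed.

Lemma free_equiv_inv (u u' : word) :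
  free_equiv u u' -> free_equiv (word_inv u) (word_inv u').
Proof.
elim=> {u u'} [u t b w|u|u u' _ uu'|u u' u'' _ uu' _ u'u''].
- rewrite /word_inv !map_cat /= !rev_cat !rev_cons -!cats1 -!catA /= negbK.
  exact: FreeCancel.
- exact: FreeRefl.
- exact: FreeSym.
- exact: FreeTrans u'u''.
Qed.

Lemma word_invK : involutive word_inv.
Proof.
move=> u; rewrite /word_inv map_rev revK -map_comp -[RHS]map_id.
by apply: eq_map => -[t b] /=; rewrite negbK.
Qed.

Lemma free_equivV (u : word) : free_equiv (word_inv u ++ u) [::].
Proof.
elim: u => [|[t b] u IHu]; first exact: FreeRefl.
rewrite /word_inv /= rev_cons cat_rcons; apply: FreeTrans IHu.
by have := FreeCancel (word_inv u) t (~~ b) u; rewrite negbK.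
Qed.

Definition free_one : free_group := of_word [::].
Definition free_mul (a b : free_group) : free_group := of_word (repr a ++ repr b).
Definition free_inv (a : free_group) : free_group := of_word (word_inv (repr a)).

Lemma free_mulE u v : free_mul (of_word u) (of_word v) = of_word (u ++ v).
Proof. by apply/of_wordP/free_equiv_cat; apply: repr_of_word. Qed.

Lemma free_invE u : free_inv (of_word u) = of_word (word_inv u).
Proof. by apply/of_wordP/free_equiv_inv/repr_of_word. Qed.

Fact free_mulA : associative free_mul.
Proof.
elim/of_word_ind => u; elim/of_word_ind => v; elim/of_word_ind => w.
by rewrite !free_mulE catA.
Qed.

Fact free_mul1 : left_id free_one free_mul.
Proof. by elim/of_word_ind => u; rewrite free_mulE. Qed.

Fact free_mulr1 : right_id free_one free_mul.
Proof. by elim/of_word_ind => u; rewrite free_mulE cats0. Qed.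

Fact free_mulV : left_inverse free_one free_inv free_mul.
Proof.
elim/of_word_ind => u; rewrite free_invE free_mulE.
exact/of_wordP/free_equivV.
Qed.

Fact free_mulrV : right_inverse free_one free_inv free_mul.
Proof.
elim/of_word_ind => u; rewrite free_invE free_mulE -{1}[u]word_invK.
exact/of_wordP/free_equivV.
Qed.

HB.instance Definition _ := isGroup.Build free_group
  free_mulA free_mul1 free_mulr1 free_mulV free_mulrV.

Definition free_gen (t : T) : free_group := of_word [:: (t, true)].

Lemma of_word_cat u v : of_word (u ++ v) = of_word u * of_word v.
Proof. by rewrite -free_mulE. Qed.

Lemma of_word_inv u : of_word (word_inv u) = (of_word u)^-1.
Proof. by rewrite -free_invE. Qed.

Section Lift.
Variables (H : groupType) (f : T -> H).

Definition word_eval (u : word) : H :=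
  \prod_(l <- u) (if l.2 then f l.1 else (f l.1)^-1).

Lemma word_eval_equiv u v : free_equiv u v -> word_eval u = word_eval v.
Proof.
elim=> {u v} // [u t b v|u v w _ -> _ //].
rewrite /word_eval !big_cat !big_cons /=; congr (_ * _).
by case: b => /=; [rewrite mulVKg | rewrite mulKg].
Qed.

Definition free_lift_fun (q : free_group) : H := word_eval (repr q).

Lemma free_lift_funE u : free_lift_fun (of_word u) = word_eval u.
Proof. exact/word_eval_equiv/repr_of_word. Qed.

Fact free_lift_funF : {morph free_lift_fun : x y / x / y}.
Proof.
have lM : {morph free_lift_fun : x y / x * y}.
  elim/of_word_ind => u; elim/of_word_ind => v.
  by rewrite -of_word_cat !free_lift_funE /word_eval big_cat.
have l1 : free_lift_fun 1 = 1.
  by apply: (mulIg (free_lift_fun 1)); rewrite -lM !mul1g.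
move=> x y; rewrite lM; congr (_ * _).
by apply: esym; apply: mulg1_eq; rewrite -lM mulgV.
Qed.

HB.instance Definition _ :=
  isGroupMorphism.Build free_group H free_lift_fun free_lift_funF.

Definition free_lift : {ghom free_group -> H} := free_lift_fun.

Lemma free_lift_gen t : free_lift (free_gen t) = f t.
Proof. by rewrite [LHS]free_lift_funE /word_eval big_seq1. Qed.

End Lift.

Lemma free_lift_unique (H : groupType) (f g : {ghom free_group -> H}) :
  (forall t, f (free_gen t) = g (free_gen t)) -> f =1 g.
Proof.
move=> fg; elim/of_word_ind; elim=> [|[t b] u IHu].
  by rewrite [of_word [::]](_ : _ = 1) // !gmulf1.
rewrite -cat1s of_word_cat !gmulfM IHu; congr (_ * _).
case: b; first exact: fg.
rewrite (_ : of_word [:: (t, false)] = (free_gen t)^-1) ?gmulfV ?fg //.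
by rewrite -of_word_inv.
Qed.

End FreeGroup.

Definition isomorphism (G H : groupType) (f : G -> H) : Prop :=
  {morph f : x y / x * y} /\ bijective f.

Definition isomorphic (G H : groupType) : Prop :=
  exists f : G -> H, isomorphism f.

Definition central_extension (G K H : groupType) (p : {ghom H -> G}) :
    Prop :=
  [/\ abelian_group K,
      (forall g, exists h, p h = g),
      (forall k h : H, ker p k -> commute k h)
    & isomorphic (set_type (ker p)) K].

(* Integer powers; Z itself as a group is [Algebra.to_multiplicative int]. *)
Definition expgz (G : groupType) (x : G) (n : int) : G :=
  match n with Posz m => x ^+ m | Negz m => x ^- m.+1 end.

Record conj_class (G : groupType) := ConjClass {
  conj_class_set :> set G;
  conj_classP : exists x, conj_class_set = [set g * x * g^-1 | g in [set: G]]
}.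

Section AssociatedGroup.
Variables (G : groupType) (X : conj_class G).

Lemma conj_classJ (a b : G) : X b -> X (a * b * a^-1).
Proof.
have [x0 ->] := conj_classP X => -[g _ <-].
by exists (a * g) => //; rewrite invgM !mulgA.
Qed.

Fact rack_subproof (x y : X) : val x * val y * (val x)^-1 \in (X : set G).
Proof. exact/mem_set/conj_classJ/set_valP. Qed.

Definition rack (x y : X) : X := SigSub (rack_subproof x y).

Definition FX := free_group (set_type X).

Definition rack_relators : set FX :=
  [set free_gen x * free_gen y * (free_gen x)^-1 * (free_gen (rack x y))^-1
    | x in [set: X] & y in [set: X]].

Definition R0 : nsubgroup FX := nclosure rack_relators.

Definition As := quotient R0.

Definition As_gen (x : X) : As := coset R0 (free_gen x).

Definition DX : subgroup As := derived As.

Definition FX_pi : {ghom FX -> G} := free_lift (fun x : X => val x).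

Definition FX_deg : {ghom FX -> Algebra.to_multiplicative int} :=
  free_lift (fun _ : X => 1%R : Algebra.to_multiplicative int).

Lemma R0_sub_ker_pi : R0 `<=` ker FX_pi.
Proof.
move=> r; apply=> _ [x _ [y _ <-]] /=.
by rewrite !gmulfM !gmulfV !free_lift_gen /= mulgV.
Qed.

Lemma R0_sub_ker_deg : R0 `<=` ker FX_deg.
Proof.
move=> r; apply=> _ [x _ [y _ <-]] /=.
by rewrite !gmulfM !gmulfV !free_lift_gen /= mulgK mulgV.
Qed.

Definition As_pi : {ghom As -> G} := quotient_lift R0_sub_ker_pi.

Definition As_deg : {ghom As -> Algebra.to_multiplicative int} :=
  quotient_lift R0_sub_ker_deg.

Lemma As_pi_gen x : As_pi (As_gen x) = val x.
Proof. by rewrite /As_pi quotient_liftE free_lift_gen. Qed.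

Lemma As_deg_gen x : As_deg (As_gen x) = 1%R.
Proof. by rewrite /As_deg quotient_liftE free_lift_gen. Qed.

Definition DX_pi : {ghom set_type DX -> G} := As_pi \o val.

Definition RX : nsubgroup FX := ker FX_pi.

Definition FR : nsubgroup FX := ncommutator (full_nsubgroup FX) RX.

Definition FmodFR := quotient FR.

Lemma FR_sub_RX : FR `<=` RX.
Proof.
move=> r; apply=> _ [a _ [b Rb <-]] /=.
by rewrite gmulfR (Rb : FX_pi b = 1) commg1.
Qed.

Definition FmodFR_pi : {ghom FmodFR -> G} := quotient_lift FR_sub_RX.

Fact RX_der1 : (RX `&` derived FX) 1.
Proof. by split; apply: subgroup1. Qed.

Fact RX_derF u v : (RX `&` derived FX) u -> (RX `&` derived FX) v ->
  (RX `&` derived FX) (u / v).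
Proof. by move=> [Ru Du] [Rv Dv]; split; apply: subgroupF. Qed.

Definition RX_der : subgroup FX := Subgroup RX_der1 RX_derF.

(* (R_X \cap [F_X, F_X]) / [F_X, R_X], as a subgroup of F_X / [F_X, R_X] *)
Definition Schur : subgroup FmodFR := image_subgroup (coset FR) RX_der.

Lemma FmodFR_ker_central (k h : FmodFR) : FmodFR_pi k = 1 -> commute h k.
Proof.
elim/coset_ind: h => h; elim/coset_ind: k => k.
rewrite quotient_liftE => Rk; apply/commgP/eqP.
rewrite -gmulfR; apply/coset_eq1/generated_sub.
by exists h => //; exists k.
Qed.

Hypothesis genX : generated_by X.

Lemma FX_pi_surj g : exists w, FX_pi w = g.
Proof.
pose I := image_subgroup FX_pi (full_subgroup FX).
suff [w _ <-] : I g by exists w.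
have : generated X g by rewrite genX.
apply=> x Xx; exists (free_gen (SigSub (mem_set Xx))) => //.
by rewrite free_lift_gen.
Qed.

Lemma FmodFR_pi_surj g : exists h, FmodFR_pi h = g.
Proof. by have [w <-] := FX_pi_surj g; exists (coset FR w); rewrite quotient_liftE. Qed.

Definition FmodFR_lift (g : G) : FmodFR := sval (cid (FmodFR_pi_surj g)).

Lemma FmodFR_liftK g : FmodFR_pi (FmodFR_lift g) = g.
Proof. exact: svalP (cid (FmodFR_pi_surj g)). Qed.

Lemma mu_indep (h h' y y' : FmodFR) :
    FmodFR_pi h = FmodFR_pi h' -> FmodFR_pi y = FmodFR_pi y' ->
  h * y * h^-1 * y^-1 = h' * y' * h'^-1 * y'^-1.
Proof.
move=> hh' yy'.
have [a ca ->] : exists2 a, (forall z, commute z a) & h = a * h'.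
  exists (h / h'); last by rewrite mulgVK.
  by move=> z; apply: FmodFR_ker_central; rewrite gmulfF hh' mulgV.
have [b cb ->] : exists2 b, (forall z, commute z b) & y = b * y'.
  exists (y / y'); last by rewrite mulgVK.
  by move=> z; apply: FmodFR_ker_central; rewrite gmulfF yy' mulgV.
exact: central_mul_commutator.
Qed.

Lemma Schur_central (m : FmodFR) : Schur m -> forall z, commute z m.
Proof.
move=> [r [Rr _] <-] z; apply: FmodFR_ker_central.
by rewrite quotient_liftE.
Qed.

Section Mu.
Variable x : X.

Fact mu_subproof (g : set_type (centralizer (val x))) :
  FmodFR_lift (val g) * FmodFR_lift (val x) *
    (FmodFR_lift (val g))^-1 * (FmodFR_lift (val x))^-1 \in (Schur : set FmodFR).
Proof.
have [w wg] := FX_pi_surj (val g); have [v vx] := FX_pi_surj (val x).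
apply/mem_set; exists [~ w^-1, v^-1].
  split; last by apply: generated_sub; exists w^-1 => //; exists v^-1.
  rewrite /RX /= gmulfR !gmulfV wg vx; apply/eqP/commgP/commuteV/commute_sym.
  exact/commuteV/set_valP.
have commE (K : groupType) (h y : K) : [~ h^-1, y^-1] = h * y * h^-1 * y^-1.
  by rewrite /commg conjgE !invgK !mulgA.
rewrite gmulfR !gmulfV !commE.
by apply: mu_indep; rewrite quotient_liftE FmodFR_liftK.
Qed.

Definition mu_fun (g : set_type (centralizer (val x))) : set_type Schur :=
  SigSub (mu_subproof g).

Lemma mu_funE g (h y : FmodFR) : FmodFR_pi h = val g -> FmodFR_pi y = val x ->
  val (mu_fun g) = h * y * h^-1 * y^-1.
Proof. by move=> hg yx; apply: mu_indep; rewrite FmodFR_liftK. Qed.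

Fact mu_funF : {morph mu_fun : a b / a / b}.
Proof.
have muM : {morph mu_fun : a b / a * b}.
  move=> a b; apply: val_inj; rewrite valM.
  have [h ha] := FmodFR_pi_surj (val a); have [k kb] := FmodFR_pi_surj (val b).
  have [y yx] := FmodFR_pi_surj (val x).
  have hkab : FmodFR_pi (h * k) = val (a * b) by rewrite gmulfM ha kb valM.
  rewrite (mu_funE hkab yx) (mu_funE ha yx).
  have cb := Schur_central (set_valP (mu_fun b)).
  rewrite cb [in RHS](mu_funE kb yx) -(mu_funE kb yx).
  have -> : h * k * y * (h * k)^-1 * y^-1 =
            h * (k * y * k^-1 * y^-1) * y * h^-1 * y^-1.
    by rewrite invgM !mulgA mulgVK.
  by rewrite -(mu_funE kb yx) cb !mulgA.
have mu1 : mu_fun 1 = 1 by apply: (mulIg (mu_fun 1)); rewrite -muM !mul1g.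
move=> a b; rewrite muM; congr (_ * _).
by apply: esym; apply: mulg1_eq; rewrite -muM mulgV.
Qed.

HB.instance Definition _ := isGroupMorphism.Build
  (set_type (centralizer (val x))) (set_type Schur) mu_fun mu_funF.

Definition mu : {ghom set_type (centralizer (val x)) -> set_type Schur} := mu_fun.

Lemma muE g (h y : FmodFR) : FmodFR_pi h = val g -> FmodFR_pi y = val x ->
  val (mu g) = h * y * h^-1 * y^-1.
Proof. exact: mu_funE. Qed.

Definition mu_image : subgroup (set_type Schur) :=
  image_subgroup mu (full_subgroup (set_type (centralizer (val x)))).

Fact mu_imageJ m u : mu_image u -> mu_image (u ^ m).
Proof.
move=> Mu; suff -> : u ^ m = u by [].
by apply: val_inj; rewrite gmulfJ conjgE (Schur_central (set_valP m)) mulKg.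
Qed.

Definition mu_nimage : nsubgroup (set_type Schur) := NSubgroup mu_imageJ.

(* M(G) / mu_x(C_G(x)) *)
Definition relative_Schur := quotient mu_nimage.

End Mu.

End AssociatedGroup.

(* Main.v *)
Require Import Defs.
From HB Require Import structures.
From mathcomp Require Import all_boot ssralg ssrint.
From mathcomp Require Import boolp classical_sets.

Set Implicit Arguments.
Unset Strict Implicit.
Unset Printing Implicit Defensive.

Local Open Scope classical_set_scope.
Local Open Scope group_scope.

(** Write [F] for the free group on [X], [R] for the kernel of [F -> G], and
    [Q = F / [F, R]], a central extension of [G].

    Conjugating a generator [g_y] of [As X] by any [a] gives the generator at
    the conjugate of [y] by [pi a] ([As_conj]).  So an element of the kernel
    of [pi : As X -> G] commutes with all generators: [As X] is a central
    extension of [G] too ([As_ker_central]), and [F -> As X] factors through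
    [q : Q -> As X] ([FmodFR_As]).  As [G] is perfect, [D_X] already maps onto
    [G], with kernel central in [D_X].

    Restricted to [M(G)], [q] maps onto the kernel of [D_X -> G], since every
    element of [D_X] lifts to [[F, F]].  It remains to see that the kernel of
    this restriction is [mu_x(C_G(x))] ([FmodFR_As_ker]).  It contains
    [mu_x(C_G(x))] because an element of [As X] lying over the centralizer of
    [x] fixes [g_x].  For the converse, let [P = mu_x(C_G(x))], a central
    subgroup of [Q].  In [Q / P] the class of [g_x] commutes with everything
    lying over [C_G(x)], so each [y] in [X] has exactly one preimage that is
    conjugate to that class.  These preimages satisfy the relations of
    [As X], whence a homomorphism [As X -> Q / P] over [G] ([As_lift]).  Its
    composite with [F -> As X] and the projection [F -> Q / P] are two
    homomorphisms over [G] into a central extension of [G]; such homomorphisms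
    have the same values on commutators ([ghom_eq_derived]).  So an element of
    [M(G)] killed in [As X] is killed in [Q / P], that is, lies in [P].

    For the splitting, [c = g_{x0}^-1 g_0] lies over [1], hence is central, and
    the map of the theorem is [g |-> (g c^{d g}, d g)].  Its first component
    lies in [D_X] because all generators are conjugate, and its inverse is
    [(u, n) |-> u c^{- n}] because [d] vanishes on [D_X] and [d c = -1]. *)

(** * Subgroups, homomorphisms and quotients *)

Section Homomorphisms.
Variables G H : groupType.
Implicit Types f g : {ghom G -> H}.

Fact preimage1 f (K : subgroup H) : [set u | K (f u)] 1.
Proof. by rewrite /= gmulf1; apply: subgroup1. Qed.

Fact preimageF f (K : subgroup H) u v :
  [set w | K (f w)] u -> [set w | K (f w)] v -> [set w | K (f w)] (u / v).
Proof. by move=> /= Ku Kv; rewrite gmulfF; apply: subgroupF. Qed.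

Definition preimage_subgroup f K :=
  Subgroup (@preimage1 f K) (@preimageF f K).

Fact equalizer1 f g : [set u | f u = g u] 1.
Proof. by rewrite /= !gmulf1. Qed.

Fact equalizerF f g u v : [set w | f w = g w] u -> [set w | f w = g w] v ->
  [set w | f w = g w] (u / v).
Proof. by move=> /= fgu fgv; rewrite !gmulfF fgu fgv. Qed.

Definition equalizer f g := Subgroup (@equalizer1 f g) (@equalizerF f g).

Lemma ghom_derived f u : derived G u -> derived H (f u).
Proof.
move/(_ (preimage_subgroup f (derived H))); apply=> _ [a _ [b _ <-]] /=.
by rewrite gmulfR; apply: generated_sub; exists (f a) => //; exists (f b).
Qed.

Lemma surj_derived f : (forall h, exists u, f u = h) ->
  forall h, derived H h -> exists2 u, derived G u & f u = h.
Proof.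
move=> surjf h /(_ (image_subgroup f (derived G))); apply=> _ [a _ [b _ <-]].
have [u <-] := surjf a; have [v <-] := surjf b.
exists [~ u, v]; last exact: gmulfR.
by apply: generated_sub; exists u => //; exists v.
Qed.

Section Corestriction.
Variables (f : {ghom G -> H}) (K : subgroup H) (fK : forall u, K (f u)).

Definition corestriction_fun of (forall u, K (f u)) : G -> set_type K :=
  fun u => SigSub (mem_set (fK u)).

Fact corestriction_funF : {morph corestriction_fun fK : x y / x / y}.
Proof. by move=> x y; apply: val_inj; rewrite gmulfF /= gmulfF. Qed.

HB.instance Definition _ :=
  isGroupMorphism.Build G (set_type K) (corestriction_fun fK) corestriction_funF.

Definition corestriction : {ghom G -> set_type K} := corestriction_fun fK.

End Corestriction.

Lemma first_isomorphism f (N : nsubgroup G) :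
    (forall h, exists u, f u = h) -> (forall u, f u = 1 <-> N u) ->
  isomorphic H (quotient N).
Proof.
move=> surjf kerf.
have fE u v : coset N u = coset N v <-> f u = f v.
  rewrite cosetP -kerf gmulfF; split; last by move=> ->; rewrite mulgV.
  exact: divg1_eq.
pose s h := sval (cid (surjf h)).
have sK h : f (s h) = h := svalP (cid (surjf h)).
exists (fun h => coset N (s h)); split.
  by move=> h h' /=; rewrite -gmulfM; apply/fE; rewrite gmulfM !sK.
exists (fun q => f (repr q)).
  by move=> h; rewrite -[RHS]sK; apply/fE; rewrite /coset reprK.
by move=> q; rewrite -[RHS]reprK; apply/fE; rewrite sK.
Qed.

End Homomorphisms.

(** On a commutator [[a, b]] the two homomorphisms agree because their values
    at [a], and at [b], differ by central elements, which cancel. *)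
Lemma ghom_eq_derived (G H K : groupType) (p : {ghom H -> K})
    (f g : {ghom G -> H}) :
    (forall k h, p k = 1 -> commute h k) -> (forall u, p (f u) = p (g u)) ->
  forall u, derived G u -> f u = g u.
Proof.
move=> kerZ pfg u /(_ (equalizer f g)); apply=> _ [a _ [b _ <-]] /=.
have fgZ v : exists2 k, (forall z, commute z k) & (f v)^-1 = k * (g v)^-1.
  exists ((f v)^-1 * g v); last by rewrite mulgK.
  by move=> z; apply: kerZ; rewrite gmulfM gmulfV pfg mulVg.
have commE (L : groupType) (x y : L) : [~ x, y] = x^-1 * y^-1 * x^-1^-1 * y^-1^-1.
  by rewrite /commg conjgE !invgK !mulgA.
rewrite !gmulfR !commE.
have [k kZ ->] := fgZ a; have [l lZ ->] := fgZ b.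
exact: central_mul_commutator.
Qed.

(** * Integer powers *)

Lemma oppz_succ (n : nat) : (- n.+1%:Z + 1 = - n%:Z)%R.
Proof. by rewrite intS GRing.opprD GRing.addrAC GRing.addNr GRing.add0r. Qed.

Section IntegerPowers.
Variable G : groupType.
Implicit Types (x y : G) (m n : int).

Lemma expgz_succ x n : expgz x (n + 1)%R = expgz x n * x.
Proof.
case: n => [n|[|n]].
- by rewrite GRing.addrC -intS /= expgSr.
- by rewrite /= mulVg.
- by rewrite /= [in RHS]expgS invgM mulgVK subn1.
Qed.

Lemma expgzD x m n : expgz x (m + n)%R = expgz x m * expgz x n.
Proof.
elim: n => [|n IHn|n IHn]; first by rewrite GRing.addr0 mulg1.
  by rewrite intS [(1 + _)%R]GRing.addrC GRing.addrA !expgz_succ IHn mulgA.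
apply: (mulIg x); rewrite -mulgA -!expgz_succ -GRing.addrA.
by rewrite oppz_succ.
Qed.

Fact expgzF x : {morph (expgz x : Algebra.to_multiplicative int -> G) : m n / m / n}.
Proof.
move=> m n; apply: (mulIg (expgz x n)).
by rewrite -[LHS]expgzD mulgVK [(_ + _)%R]GRing.subrK.
Qed.

HB.instance Definition _ x :=
  isGroupMorphism.Build (Algebra.to_multiplicative int) G (expgz x) (expgzF x).

Lemma commute_expgz x y n : commute x y -> commute x (expgz y n).
Proof. by move=> xy; case: n => n /=; [|apply: commuteV]; apply: commuteX. Qed.

Lemma expgzMn x y n : commute x y -> expgz (x * y) n = expgz x n * expgz y n.
Proof.
case: n => n xy /=; rewrite expgMn // invgM.
by apply/commuteV/commute_sym/commuteV/commute_sym/commuteX2.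
Qed.

End IntegerPowers.

Lemma gmulf_expgz (G H : groupType) (f : {ghom G -> H}) x n :
  f (expgz x n) = expgz (f x) n.
Proof. by case: n => n /=; rewrite ?gmulfV gmulfXn. Qed.

Lemma expgz_int (a : Algebra.to_multiplicative int) n :
  expgz a n = ((a : int) * n)%R.
Proof.
elim: n => [|n IHn|n IHn]; first by rewrite GRing.mulr0.
  by rewrite intS GRing.addrC expgz_succ IHn GRing.mulrDr GRing.mulr1.
apply: (mulIg a); rewrite -expgz_succ.
by rewrite oppz_succ IHn -oppz_succ GRing.mulrDr GRing.mulr1.
Qed.

(** With [c = g_{x0}^-1 g_0] this is the first component of the splitting:
    centrality of [c] merges the two powers there into one, and makes the map
    a homomorphism. *)
Section Twist.
Variables (G : groupType) (d : {ghom G -> Algebra.to_multiplicative int}) (c : G).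
Hypothesis cZ : forall g : G, commute g c.

Definition twist_fun of (forall g : G, commute g c) : G -> G :=
  fun g => g * expgz c (d g).

Fact twist_funF : {morph twist_fun cZ : u v / u / v}.
Proof.
move=> u v; rewrite /twist_fun gmulfF invgM -!mulgA; congr (_ * _).
by rewrite (commute_expgz _ (cZ v^-1)) expgzF !mulgA.
Qed.

HB.instance Definition _ := isGroupMorphism.Build G G (twist_fun cZ) twist_funF.

Definition twist : {ghom G -> G} := twist_fun cZ.

Lemma twistE g : twist g = g * expgz c (d g).
Proof. by []. Qed.

End Twist.

(** * The associated group *)

Lemma free_gen_generated (T : choiceType) (S : subgroup (free_group T)) :
  (forall t, S (free_gen t)) -> forall u, S u.
Proof.
move=> Sgen; elim/of_word_ind; elim=> [|[t b] u IHu]; first exact: subgroup1.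
rewrite -cat1s of_word_cat; apply: subgroupM => //.
case: b; first exact: Sgen.
by rewrite (of_word_inv [:: (t, true)]); apply/subgroupV/Sgen.
Qed.

Section AssociatedGroup.
Variables (G : groupType) (X : conj_class G).
Implicit Types (x y z : X) (a b : As X).

Lemma As_piE u : As_pi X (coset (R0 X) u) = FX_pi X u.
Proof. exact: quotient_liftE. Qed.

Lemma FmodFR_piE u : FmodFR_pi X (coset (FR X) u) = FX_pi X u.
Proof. exact: quotient_liftE. Qed.

Lemma As_generated (S : subgroup (As X)) : (forall x, S (As_gen x)) -> forall a, S a.
Proof.
move=> Sgen; elim/coset_ind => u.
exact: (@free_gen_generated _ (preimage_subgroup (coset (R0 X)) S)).
Qed.

Lemma As_ext (H : groupType) (f g : {ghom As X -> H}) :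
  (forall x, f (As_gen x) = g (As_gen x)) -> f =1 g.
Proof. by move=> fg a; apply: (@As_generated (equalizer f g)). Qed.

Lemma As_gen_rack x y : As_gen x * As_gen y * (As_gen x)^-1 = As_gen (rack x y).
Proof.
have : coset (R0 X) (free_gen x * free_gen y * (free_gen x)^-1 *
                     (free_gen (rack x y))^-1) = 1.
  by apply/coset_eq1 => N; apply; exists x => //; exists y.
by rewrite !gmulfM !gmulfV => /divg1_eq.
Qed.

(** The condition relates two points [y] and [z] of the rack, instead of naming
    the conjugate of [y], so that no membership proof occurs in it and it
    passes to quotients [a / b] through the point from which [b] leads to [y]. *)
Definition permutes_gens : set (As X) :=
  [set a | forall y z, As_pi X a * val y * (As_pi X a)^-1 = val z ->
    a * As_gen y * a^-1 = As_gen z].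

Fact permutes_gens1 : permutes_gens 1.
Proof. by move=> y z; rewrite gmulf1 !invg1 !mul1g !mulg1 => /val_inj->. Qed.

Fact permutes_gensF a b :
  permutes_gens a -> permutes_gens b -> permutes_gens (a / b).
Proof.
move=> Sa Sb y z; rewrite gmulfF invgF !mulgA => yz.
have Xt : (X : set G) ((As_pi X b)^-1 * val y * (As_pi X b)).
  by rewrite -{2}[As_pi X b]invgK; apply/conj_classJ/set_valP.
pose t : X := SigSub (mem_set Xt).
rewrite -(Sb t y) /=; last by rewrite !mulgA mulgV mul1g mulgK.
rewrite -(Sa t z) /=; last by rewrite !mulgA.
by rewrite invgF !mulgA !mulgVK.
Qed.

Lemma As_conj a y z : As_pi X a * val y * (As_pi X a)^-1 = val z ->
  a * As_gen y * a^-1 = As_gen z.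
Proof.
move: y z; apply: (@As_generated (Subgroup permutes_gens1 permutes_gensF)) => x y z.
rewrite As_pi_gen => xyz; have -> : z = rack x y by apply: val_inj; rewrite -xyz.
exact: As_gen_rack.
Qed.

(** An element over [1] moves no point of [X], so it commutes with every
    generator. *)
Lemma As_ker_central a b : As_pi X a = 1 -> commute b a.
Proof.
move=> a1; apply/commute_sym; move: b.
apply: (@As_generated (centralizer a)) => x.
suff e : a * As_gen x * a^-1 = As_gen x by rewrite /= /commute -[in RHS]e mulgVK.
by apply: As_conj; rewrite a1 mul1g invg1 mulg1.
Qed.

Lemma conj_class_trans x y : exists g, g * val x * g^-1 = val y.
Proof.
have [g0 Xg0] := conj_classP X.
have [g _ <-] : [set g * g0 * g^-1 | g in [set: G]] (val x).
  by rewrite -Xg0; apply: set_valP.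
have [h _ <-] : [set g * g0 * g^-1 | g in [set: G]] (val y).
  by rewrite -Xg0; apply: set_valP.
by exists (h / g); rewrite invgF !mulgA !mulgVK.
Qed.

(** Let [h0] lie over [x] and commute with everything over the centralizer of
    [x].  Then a conjugate of [h0] is determined by its image in [G], so the
    conjugates of [h0] form a copy of the rack [X] inside [H], and sending each
    generator to its copy respects the relations of [As X]. *)
Lemma As_lift (H : groupType) (p : {ghom H -> G}) (x : X) (h0 : H) :
    (forall g, exists h, p h = g) -> p h0 = val x ->
    (forall h, commute (val x) (p h) -> commute h0 h) ->
  exists phi : {ghom As X -> H}, forall a, p (phi a) = As_pi X a.
Proof.
move=> surjp ph0 ch0.
(* [h'^-1 * h] lies over the centralizer of [x]. *)
have uniq h h' : p (h * h0 * h^-1) = p (h' * h0 * h'^-1) ->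
    h * h0 * h^-1 = h' * h0 * h'^-1.
  move=> e; have /ch0 c : commute (val x) (p (h'^-1 * h)).
    rewrite /commute -ph0 -!gmulfM; apply: (mulgI (p h')); apply: (mulIg (p h^-1)).
    by rewrite -!gmulfM !mulgA mulgV mul1g mulgK e.
  apply: (mulIg h); apply: (mulgI h'^-1).
  by rewrite mulgVK !mulgA mulVg mul1g -[RHS]mulgA [RHS]c.
have ex y : exists h, p (h * h0 * h^-1) = val y.
  have [g xy] := conj_class_trans x y; have [h ph] := surjp g.
  by exists h; rewrite !gmulfM gmulfV /= ph ph0.
have [k pk] := choice ex.
have [s sE] : exists s, forall y, s y = k y * h0 * (k y)^-1 by eexists.
have ps y : p (s y) = val y by rewrite sE.
have R0s : R0 X `<=` ker (free_lift s).
  move=> r; apply=> _ [a _ [b _ <-]] /=.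
  rewrite !gmulfM !gmulfV !free_lift_gen.
  suff -> : s a * s b * (s a)^-1 = s (rack a b) by rewrite mulgV.
  have e : s a * s b * (s a)^-1 = s a * k b * h0 * (s a * k b)^-1.
    by rewrite invgM (sE b) !mulgA.
  by rewrite e (sE (rack a b)); apply: uniq; rewrite -e -sE !gmulfM gmulfV /= !ps.
exists (quotient_lift R0s).
apply: (@As_ext _ (p \o quotient_lift R0s)) => y.
by rewrite As_pi_gen -ps -(free_lift_gen s); congr (p _); apply: quotient_liftE.
Qed.

(** * The derived group of the associated group *)

Section Generated.
Hypothesis genX : generated_by X.

Lemma As_pi_surj g : exists a, As_pi X a = g.
Proof.
have [u <-] := FX_pi_surj genX g; exists (coset _ u); exact: quotient_liftE.
Qed.

Lemma As_gen_conj x y : exists a, a * As_gen x * a^-1 = As_gen y.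
Proof.
have [g xy] := conj_class_trans x y; have [a ag] := As_pi_surj g.
by exists a; apply: As_conj; rewrite ag.
Qed.

Lemma As_deg_derived a : (DX X) a -> As_deg X a = 1.
Proof.
move/(_ (ker (As_deg X))); apply=> _ [b _ [b' _ <-]].
suff: As_deg X [~ b, b'] = 1 by [].
by rewrite gmulfR; apply/eqP/commgP/GRing.addrC.
Qed.

(** A generator [g_y] is conjugate to [g_x], so [g_y g_x^-1] is a commutator;
    twisting by [g_x^-1 a0] therefore moves the generators into [D_X]. *)
Lemma twist_DX x a0 (cZ : forall a, commute a ((As_gen x)^-1 * a0)) :
  (DX X) a0 -> forall a, (DX X) (twist (As_deg X) cZ a).
Proof.
move=> Da0; apply: (@As_generated (preimage_subgroup (twist (As_deg X) cZ) (DX X))).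
move=> y; suff: DX X (As_gen y * ((As_gen x)^-1 * a0)).
  by have := twistE (As_deg X) cZ (As_gen y); rewrite As_deg_gen /= => ->.
have [a <-] := As_gen_conj x y.
rewrite mulgA; apply: subgroupM => //; apply: generated_sub.
exists a^-1 => //; exists (As_gen x)^-1 => //.
by rewrite /commg conjgE !invgK !mulgA.
Qed.

(** * The relative Schur multiplier *)

(** Conjugation by a lift of [a] carries [mu_x g] to [mu_y (a g a^-1)] when
    [y = a x a^-1], and fixes it because [M(G)] is central. *)
Lemma mu_image_sub x y : mu_image genX x `<=` mu_image genX y.
Proof.
move=> _ [g _ <-]; have [a xy] := conj_class_trans x y.
have [k ka] := FmodFR_pi_surj genX a.
have [h hg] := FmodFR_pi_surj genX (val g).
have [v vx] := FmodFR_pi_surj genX (val x).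
have cg : commute (val y) (a * val g * a^-1).
  have cj (u w : G) : a * u * a^-1 * (a * w * a^-1) = a * (u * w) * a^-1.
    by rewrite !mulgA mulgVK.
  rewrite /commute -xy !cj; congr (_ * _ * _).
  exact: (set_valP g : commute (val x) (val g)).
pose g' : set_type (centralizer (val y)) :=
  SigSub (mem_set (cg : centralizer (val y) (a * val g * a^-1))).
exists g' => //; apply: val_inj.
have e1 : FmodFR_pi X (k * h * k^-1) = a * val g * a^-1.
  by rewrite -ka -hg !gmulfM gmulfV.
have e2 : FmodFR_pi X (k * v * k^-1) = val y by rewrite -xy -ka -vx !gmulfM gmulfV.
have mZ := Schur_central (set_valP (mu genX x g)).
rewrite (muE genX (g := g') e1 e2).
rewrite -[RHS](mulgK k) -mZ (muE genX hg vx).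
by rewrite !invgM !invgK !mulgA !mulgVK.
Qed.

Lemma mu_image_indep x y : mu_image genX x = mu_image genX y :> set _.
Proof. by apply/seteqP; split; apply: mu_image_sub. Qed.

Lemma FR_sub_R0 : FR X `<=` ker (coset (R0 X)).
Proof.
move=> r; apply=> _ [u _ [v Rv <-]].
suff: coset (R0 X) [~ u, v] = 1 by [].
rewrite gmulfR; apply/eqP/commgP/As_ker_central.
by rewrite As_piE.
Qed.

Definition FmodFR_As : {ghom FmodFR X -> As X} := quotient_lift FR_sub_R0.

Lemma FmodFR_AsE u : FmodFR_As (coset (FR X) u) = coset (R0 X) u.
Proof. exact: quotient_liftE. Qed.

Lemma FmodFR_As_pi h : As_pi X (FmodFR_As h) = FmodFR_pi X h.
Proof. by elim/coset_ind: h => u; rewrite FmodFR_AsE As_piE FmodFR_piE. Qed.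

Section MuQuotient.
Variable x : X.

Fact mu_values1 : [set h : FmodFR X | exists2 m, mu_image genX x m & val m = h] 1.
Proof. by exists 1; [apply: subgroup1 | rewrite gmulf1]. Qed.

Fact mu_valuesF (u v : FmodFR X) :
  let S := [set h : FmodFR X | exists2 m, mu_image genX x m & val m = h] in
  S u -> S v -> S (u / v).
Proof.
move=> S [m Mm <-] [n Mn <-]; exists (m / n); first exact: subgroupF.
by rewrite gmulfF.
Qed.

Fact mu_valuesJ (g u : FmodFR X) :
  Subgroup mu_values1 mu_valuesF u -> Subgroup mu_values1 mu_valuesF (u ^ g).
Proof.
move=> [m Mm <-]; exists m => //.
by rewrite conjgE -(Schur_central (set_valP m)) mulKg.
Qed.

(** The values of [mu_x] as a normal subgroup of [F / [F, R]], where one can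
    divide by it without leaving the extensions of [G]. *)
Definition mu_values : nsubgroup (FmodFR X) := NSubgroup mu_valuesJ.

Lemma mu_values_pi : mu_values `<=` ker (FmodFR_pi X).
Proof.
move=> _ [m _ <-]; have [u [Ru _] <-] := set_valP m.
exact: etrans (FmodFR_piE u) Ru.
Qed.

Definition FmodMu_pi : {ghom quotient mu_values -> G} := quotient_lift mu_values_pi.

Lemma FmodMu_piE h : FmodMu_pi (coset mu_values h) = FmodFR_pi X h.
Proof. exact: quotient_liftE. Qed.

Lemma FmodMu_ker_central k q : FmodMu_pi k = 1 -> commute q k.
Proof.
elim/coset_ind: k => k; elim/coset_ind: q => h; rewrite FmodMu_piE => k1.
exact/gmulf_commute/FmodFR_ker_central.
Qed.

(** The commutator of a lift of [g] in [C_G(x)] with [g_x] is [mu_x g], which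
    dividing by the values of [mu_x] kills. *)
Lemma coset_mu_commute h : commute (val x) (FmodFR_pi X h) ->
  commute (coset mu_values (coset (FR X) (free_gen x))) (coset mu_values h).
Proof.
move=> cxh; pose g : set_type (centralizer (val x)) :=
  SigSub (mem_set (cxh : centralizer (val x) (FmodFR_pi X h))).
have hg : FmodFR_pi X h = val g by [].
have vx : FmodFR_pi X (coset _ (free_gen x)) = val x.
  by rewrite FmodFR_piE; apply: free_lift_gen.
set v := coset (FR X) _ in vx *.
have e : coset mu_values (h * v * h^-1 * v^-1) = 1.
  apply/coset_eq1; rewrite -(muE genX hg vx).
  by exists (mu genX x g) => //; exists g.
by apply/commute_sym/divg1_eq; rewrite invgM mulgA -[RHS]e !gmulfM !gmulfV.
Qed.

(** If [m] dies in [As X], then so does its image in the quotient by the values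
    of [mu_x], because on commutators the projection to that quotient agrees
    with the homomorphism through [As X] provided by [As_lift]. *)
Lemma FmodFR_As_ker m : (Schur X) m -> FmodFR_As m = 1 <-> mu_values m.
Proof.
move=> Sm; split; last first.
  move=> [_ [g _ <-] <-].
  have [h hg] := FmodFR_pi_surj genX (val g).
  have vx : FmodFR_pi X (coset _ (free_gen x)) = val x.
    by rewrite FmodFR_piE; apply: free_lift_gen.
  have cxg : commute (val x) (val g) := set_valP g.
  rewrite (muE genX hg vx); set v := coset (FR X) _ in vx *.
  have qv : FmodFR_As v = As_gen x by apply: FmodFR_AsE.
  have qh : FmodFR_As h * As_gen x * (FmodFR_As h)^-1 = As_gen x.
    by apply: As_conj; rewrite FmodFR_As_pi hg -cxg mulgK.
  transitivity (FmodFR_As h * FmodFR_As v * (FmodFR_As h)^-1 * (FmodFR_As v)^-1).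
    by rewrite !gmulfM !gmulfV.
  by rewrite qv qh mulgV.
move=> m1; have [r [Rr Dr] rm] := Sm.
have [||h|phi phiE] := @As_lift _ FmodMu_pi x (coset _ (coset _ (free_gen x))).
- move=> g; have [h <-] := FmodFR_pi_surj genX g.
  by exists (coset _ h); apply: FmodMu_piE.
- rewrite FmodMu_piE FmodFR_piE; apply: free_lift_gen.
- by elim/coset_ind: h => h; rewrite FmodMu_piE; apply: coset_mu_commute.
apply/(coset_eq1 mu_values); rewrite -rm.
have e := @ghom_eq_derived _ _ _ FmodMu_pi (phi \o coset (R0 X))
  (coset mu_values \o coset (FR X)) FmodMu_ker_central _ r Dr.
rewrite -[LHS]e /=; first by rewrite -FmodFR_AsE rm m1 gmulf1.
move=> u; apply: etrans (phiE _) _; rewrite As_piE.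
by apply: esym; apply: etrans (FmodMu_piE _) (FmodFR_piE u).
Qed.

Lemma Schur_DX (m : set_type (Schur X)) : DX X (FmodFR_As (val m)).
Proof.
have [u [_ Du] <-] := set_valP m; rewrite FmodFR_AsE.
exact: (@ghom_derived _ _ (coset (R0 X)) u Du).
Qed.

Definition Schur_to_DX : {ghom set_type (Schur X) -> set_type (DX X)} :=
  corestriction (f := FmodFR_As \o val) Schur_DX.

Lemma Schur_ker (m : set_type (Schur X)) : ker (DX_pi X) (Schur_to_DX m).
Proof.
suff: As_pi X (FmodFR_As (val m)) = 1 by [].
by rewrite FmodFR_As_pi; have [u [Ru _] <-] := set_valP m; rewrite FmodFR_piE.
Qed.

Definition Schur_to_ker : {ghom set_type (Schur X) -> set_type (ker (DX_pi X))} :=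
  corestriction Schur_ker.

(** Since commutators lift along [F -> As X], an element of [D_X] over [1] is
    the image of some [u] in [[F, F]]; then [u] lies in [R], so it represents an
    element of [M(G)]. *)
Lemma Schur_to_ker_surj k : exists m, Schur_to_ker m = k.
Proof.
have kR : As_pi X (val (val k)) = 1 := set_valP k.
have [u Du uk] : exists2 u, derived (FX X) u & coset (R0 X) u = val (val k).
  apply: surj_derived (set_valP (val k)).
  by elim/coset_ind => u; exists u.
have Ru : RX X u by rewrite -uk As_piE in kR.
have Sm : Schur X (coset (FR X) u) by exists u.
exists (SigSub (mem_set Sm)); apply: val_inj; apply: val_inj.
exact: etrans (FmodFR_AsE u) uk.
Qed.

Lemma Schur_to_ker_eq1 m : Schur_to_ker m = 1 <-> mu_nimage genX x m.
Proof.
have -> : Schur_to_ker m = 1 <-> FmodFR_As (val m) = 1.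
  split=> [m1|m1]; last by apply: val_inj; apply: val_inj.
  by have := congr1 (val \o val) m1.
rewrite FmodFR_As_ker; last exact: set_valP.
split=> [[n Mn nm]|Mm]; last by exists m.
by rewrite -(val_inj nm).
Qed.

Lemma DX_kernel : isomorphic (set_type (ker (DX_pi X))) (relative_Schur genX x).
Proof. exact: first_isomorphism Schur_to_ker_surj Schur_to_ker_eq1. Qed.

Lemma relative_Schur_abelian : abelian_group (relative_Schur genX x).
Proof.
elim/coset_ind => m; elim/coset_ind => n; rewrite -!gmulfM; congr (coset _ _).
by apply: val_inj; rewrite !valM; apply/Schur_central/set_valP.
Qed.

End MuQuotient.

Lemma DX_pi_surj : perfect G -> forall g, exists h, DX_pi X h = g.
Proof.
move=> perfG g; have Dg : derived G g by rewrite perfG.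
have [a Da ag] := surj_derived As_pi_surj Dg.
by exists (SigSub (mem_set Da)).
Qed.

Lemma DX_ker_central k h : ker (DX_pi X) k -> commute k h.
Proof.
move=> k1; apply: val_inj; rewrite !valM.
exact/commute_sym/As_ker_central.
Qed.

(** * The splitting of the associated group *)

Section Splitting.
Variables (x0 : X) (g0 : set_type (DX X)).
Hypothesis pig0 : DX_pi X g0 = val x0.

Lemma shift_central a : commute a ((As_gen x0)^-1 * val g0).
Proof.
apply: As_ker_central; rewrite gmulfM gmulfV As_pi_gen -pig0.
exact: mulVg.
Qed.

Definition As_to_DX : {ghom As X -> set_type (DX X)} :=
  corestriction (twist_DX shift_central (set_valP g0)).

Lemma As_to_DXE a : val (As_to_DX a) =
  a * expgz (As_gen x0) (- (As_deg X a : int))%R * expgz (val g0) (As_deg X a).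
Proof.
apply: etrans (twistE _ shift_central a) _; rewrite -mulgA; congr (_ * _).
set n := As_deg X a; set c := _ * val g0.
have -> : val g0 = As_gen x0 * c by rewrite mulVKg.
rewrite (expgzMn _ (shift_central (As_gen x0) : commute _ c)).
by rewrite mulgA -expgzD GRing.addNr mul1g.
Qed.

Lemma As_splitting :
  isomorphism (fun a => (As_to_DX a, As_deg X a)).
Proof.
split; first by move=> a b; rewrite !gmulfM.
pose c := (As_gen x0)^-1 * val g0.
have degc : As_deg X c = (-1 : int)%R.
  by rewrite gmulfM gmulfV As_deg_gen (As_deg_derived (set_valP g0)) mulg1.
(* [c] has degree -1, so [u c^{- n}] is the preimage of degree [n]. *)
exists (fun un => val un.1 * expgz c (- (un.2 : int))%R) => [a|[u n]].
  rewrite /= [X in X * _](twistE _ shift_central a) -/c -mulgA -expgzD.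
  by rewrite GRing.subrr mulg1.
have degn : As_deg X (val u * expgz c (- (n : int))%R) = n.
  rewrite gmulfM (As_deg_derived (set_valP u)) mul1g gmulf_expgz degc.
  by rewrite expgz_int GRing.mulN1r GRing.opprK.
congr (_, _); last exact: degn.
apply: val_inj; apply: etrans (twistE _ shift_central _) _; rewrite degn.
by rewrite -/c -mulgA -expgzD GRing.addNr mulg1.
Qed.

End Splitting.

End Generated.
End AssociatedGroup.

Theorem theorem6p9 (G : groupType) (X : conj_class G)
    (perfG : perfect G) (genX : generated_by X) :
  [/\ forall x y : X, mu_image genX x = mu_image genX y :> set (set_type (Schur X)),
      forall x : X, central_extension (relative_Schur genX x) (DX_pi X)
    & forall (x0 : X) (g0 : set_type (DX X)), DX_pi X g0 = val x0 ->
      exists2 f : As X -> set_type (DX X) * Algebra.to_multiplicative int,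
        forall g : As X,
          val (f g).1 = g * expgz (As_gen x0) (- (As_deg X g : int))%R
                          * expgz (val g0) (As_deg X g)
          /\ (f g).2 = As_deg X g
      & isomorphism f].
Proof.
split=> [x y|x|x0 g0 pig0]; first exact: mu_image_indep.
  split; [exact: relative_Schur_abelian | exact: DX_pi_surj | | exact: DX_kernel].
  exact: DX_ker_central.
exists (fun a => (As_to_DX genX pig0 a, As_deg X a)); last exact: As_splitting.
by move=> a; split=> //; apply: As_to_DXE.
Qed.
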